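(* Let $T=\{2143,2341,3241\}$. Then $$F_T(x)=\frac{1-4x+3x^2-x^3}{1-5x+6x^2-3x^3}.$$
   Context: $S_n(T)$ denotes the set of permutations $\pi$ of $[n]=\{1,\dots,n\}$ (one-line notation) that avoid every pattern $\tau\in T$, i.e. no subsequence of $\pi$ is order-isomorphic to $\tau$. $F_T(x)=\sum_{n\ge 0}|S_n(T)|x^n$, a formal power series, with $|S_0(T)|=1$. *)

(* Defs.v *)
From mathcomp Require Import all_boot all_order all_fingroup all_algebra.

Set Implicit Arguments.
Unset Strict Implicit.
Unset Printing Implicit Defensive.

Import GRing.Theory.

(* Permutations of [n] are elements of 'S_n, i.e. permutations of
   {0, ..., n-1}; the shift by one recovers the values 1, ..., n.
   Patterns are given by their one-line notation. *)
Definition oneline n (p : 'S_n) : seq nat := [seq (val (p i)).+1 | i <- enum 'I_n].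

Definition order_iso (u v : seq nat) : bool :=
  (size u == size v) &&
  [forall i : 'I_(size u), forall j : 'I_(size u),
     (nth 0 u i < nth 0 u j) == (nth 0 v i < nth 0 v j)].

(* The subsequences of w are the sequences mask m w. *)
Definition contains (w tau : seq nat) : bool :=
  [exists m : (size w).-tuple bool, order_iso (mask m w) tau].

Definition avoids (w tau : seq nat) : bool := ~~ contains w tau.

Definition avoiders (T : seq (seq nat)) n : {set 'S_n} :=
  [set p : 'S_n | all (avoids (oneline p)) T].

Lemma containsP w tau :
  reflect (exists2 u, subseq u w & order_iso u tau) (contains w tau).
Proof.
apply: (iffP existsP) => [[m tau_m] | [u /subseqP[m sz_m ->] tau_u]].
  by exists (mask m w) => //; apply: mask_subseq.
by move/eqP: sz_m => sz_m; exists (Tuple sz_m).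
Qed.

Lemma card_avoiders0 (T : seq (seq nat)) :
  [::] \notin T -> #|avoiders T 0| = 1.
Proof.
move=> T0; apply/eqP/cards1P; exists 1%g; apply/setP=> p; rewrite !inE.
have -> : p = 1%g by apply/permP; case.
rewrite eqxx; apply/allP=> tau Ttau; apply/containsP=> -[u].
have -> : oneline (1%g : 'S_0) = [::].
  by apply/nilP; rewrite /nilp size_map size_enum_ord.
rewrite subseq0 => /eqP-> /andP[/eqP/esym/size0nil tau0 _].
by move: T0; rewrite -tau0 Ttau.
Qed.

Local Open Scope ring_scope.

(* A formal power series is its sequence of coefficients; two series are equal
   when their coefficients agree (=1). *)
Definition fps (R : Type) := nat -> R.

Section FormalPowerSeries.
Variable R : comUnitRingType.
Implicit Types f g : fps R.

Definition fps_poly (p : {poly R}) : fps R := fun n => p`_n.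

Definition fps_mul f g : fps R := fun n => \sum_(i < n.+1) f (n - i)%N * g i.

(* The first n coefficients of the inverse of f; the coefficient g_k is
   obtained by solving \sum_(i <= k) f_(k-i) g_i = [k = 0] for g_k. *)
Fixpoint fps_inv_coefs f n : seq R :=
  if n is k.+1 then
    let g := fps_inv_coefs f k in
    rcons g ((f 0%N)^-1 * ((k == 0%N)%:R - \sum_(i < k) f (k - i)%N * g`_i))
  else [::].

Definition fps_inv f : fps R := fun n => (fps_inv_coefs f n.+1)`_n.

Definition fps_div f g : fps R := fps_mul f (fps_inv g).

Lemma size_fps_inv_coefs f n : size (fps_inv_coefs f n) = n.
Proof. by elim: n => //= n IHn; rewrite size_rcons IHn. Qed.

Lemma nth_fps_inv_coefs f n i : (i < n)%N -> (fps_inv_coefs f n)`_i = fps_inv f i.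
Proof.
elim: n => // n IHn; rewrite ltnS leq_eqVlt => /predU1P[-> // | lt_in].
by rewrite /= nth_rcons size_fps_inv_coefs lt_in IHn.
Qed.

Lemma fps_mulV f : f 0%N \is a GRing.unit -> fps_mul f (fps_inv f) =1 fps_poly 1.
Proof.
move=> Uf n; rewrite /fps_mul /fps_poly big_ord_recr /= subnn {2}/fps_inv /=.
rewrite nth_rcons size_fps_inv_coefs ltnn eqxx mulVKr // coef1.
rewrite (eq_bigr (fun i : 'I_n => f (n - i)%N * (fps_inv_coefs f n)`_i)).
  by rewrite addrC subrK.
by move=> i _; rewrite nth_fps_inv_coefs.
Qed.

End FormalPowerSeries.

Definition avoid_gf (T : seq (seq nat)) : fps rat :=
  fun n => #|avoiders T n|%:R.

(* Main.v *)
Require Import Defs.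
From mathcomp Require Import all_boot all_order all_fingroup all_algebra.
From mathcomp Require Import zify ring.

(* Let a_n = |S_n(T)| and let b_n count the avoiders that do not begin with 1.
   A leading 1 takes part in no forbidden pattern, so a_n = a_(n-1) + b_n.
   Write an avoider as L M R with M its maximum.  If d is in R then at most one
   entry of L exceeds d (2341, 3241), and d is below the top of every inversion
   of L (2143).  Hence an avoider of length n+2 that does not begin with 1 is
     - M R, with R any avoider;
     - L M, with L an avoider not beginning with 1;
     - m M R, with m R an avoider not beginning with 1;
     - (M-1) 1 2 ... j M R, with 1 <= j, R nonempty, and R - j any avoider;
   and all of these avoid T.  So b_(n+2) = a_(n+1) + 2 b_(n+1) + sum_(0<r<n) a_r,
   and differencing gives a_(n+4) = 5 a_(n+3) - 6 a_(n+2) + 3 a_(n+1). *)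

Set Implicit Arguments.
Unset Strict Implicit.
Unset Printing Implicit Defensive.

Import GRing.Theory.

(** * Avoidance as a condition on four letters *)

Definition T23 : seq (seq nat) :=
  [:: [:: 2; 1; 4; 3]; [:: 2; 3; 4; 1]; [:: 3; 2; 4; 1]].

Definition good (w : seq nat) : bool := all (avoids w) T23.

(* The first disjunct is the pattern 2143; the second one merges 2341 and 3241,
   which differ only by the order of their first two letters. *)
Definition bad4 (p q r s : nat) : bool :=
  [&& q < p, p < s & s < r] || [&& s < p, s < q, p < r & q < r].

Lemma order_isoP (u v : seq nat) :
  reflect (size u = size v /\
           forall i j, i < size u -> j < size u ->
             (nth 0 u i < nth 0 u j) = (nth 0 v i < nth 0 v j))
          (order_iso u v).
Proof.
apply: (iffP andP) => [[/eqP-> uv]|[-> uv]]; split=> //; rewrite ?eqxx //.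
  move=> i j lti ltj.
  by move/forallP/(_ (Ordinal lti))/forallP/(_ (Ordinal ltj))/eqP: uv.
by apply/forallP=> i; apply/forallP=> j; apply/eqP/uv.
Qed.

(** Distinct letters are essential: [p = q] could satisfy the second half of [bad4] without matching
    a pattern. *)
Lemma goodP (w : seq nat) : uniq w ->
  reflect (forall p q r s, subseq [:: p; q; r; s] w -> ~~ bad4 p q r s) (good w).
Proof.
move=> uw; apply: (iffP allP) => [gw p q r s sw|gw tau].
  have: uniq [:: p; q; r; s] by apply: subseq_uniq sw uw.
  rewrite /= !inE => upqrs; apply/negP => bad.
  have av tau : tau \in T23 -> ~~ order_iso [:: p; q; r; s] tau.
    move=> Ttau; apply: contra (gw _ Ttau) => iso.
    by apply/containsP; exists [:: p; q; r; s].
  have iso : has (order_iso [:: p; q; r; s]) T23.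
    rewrite /= orbF; case/orP: bad => [bad|bad].
      apply/or3P/Or31/order_isoP; split=> // -[|[|[|[|i]]]] // [|[|[|[|j]]]] //= _ _; lia.
    (* The merged condition splits: an ascent [p < q] gives 2341, a descent gives 3241. *)
    have [ltpq|ltqp] := ltnP p q; apply/or3P; [apply: Or32|apply: Or33];
      apply/order_isoP; split=> // -[|[|[|[|i]]]] // [|[|[|[|j]]]] //= _ _; lia.
  by case/hasP: iso => tau Ttau; apply/negP/av.
rewrite !inE => Ttau; apply/containsP => -[u sw /order_isoP[szu cmp]].
case: u sw szu cmp => [|p [|q [|r [|s [|? ?]]]]] sw /= szu cmp;
  try by case/or3P: Ttau szu => /eqP->.
have /negP := gw _ _ _ _ sw; apply; rewrite /bad4.
have := cmp 0 1 isT isT; have := cmp 0 2 isT isT; have := cmp 0 3 isT isT.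
have := cmp 1 0 isT isT; have := cmp 1 2 isT isT; have := cmp 3 1 isT isT.
have := cmp 3 2 isT isT; have := cmp 3 0 isT isT.
case/or3P: Ttau => /eqP-> /=; lia.
Qed.

(** * Operations on words that preserve avoidance *)

Lemma good_subseq (v w : seq nat) : uniq w -> subseq v w -> good w -> good v.
Proof.
move=> uw svw /(goodP uw) gw; apply/goodP; first exact: subseq_uniq svw uw.
by move=> p q r s /subseq_trans/(_ svw); apply: gw.
Qed.

(** Monotonicity is asked only on the letters of [w], so that truncated subtraction qualifies when
    all letters are large enough. *)
Lemma good_map (f : nat -> nat) (w : seq nat) : uniq w ->
  {in w &, {mono f : x y / x < y}} -> good (map f w) -> good w.
Proof.
move=> uw fm gfw; have fi : {in w &, injective f}.
  move=> x y xw yw fxy; have := fm x y xw yw; have := fm y x yw xw; lia.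
have /goodP gP: uniq (map f w) by rewrite map_inj_in_uniq.
apply/goodP => // p q r s sw; have := gP gfw _ _ _ _ (map_subseq f sw).
have /allP: all (mem w) [:: p; q; r; s] by apply/allP; apply: mem_subseq.
move=> inw; rewrite /bad4 !fm //; apply: inw; rewrite !inE eqxx ?orbT //.
Qed.

Lemma good_cons (a : nat) w : uniq (a :: w) -> good w ->
  (forall q r s, subseq [:: q; r; s] w -> ~~ bad4 a q r s) -> good (a :: w).
Proof.
move=> uaw gw ga; have /andP[_ uw] := uaw; apply/goodP=> // p q r s.
rewrite [subseq _ _]/=; case: eqP => [-> |_]; first exact: ga.
by move/(goodP uw): gw; apply.
Qed.

(** In each pattern the first letter exceeds the second or the fourth, so a minimum cannot start an
    occurrence. *)
Lemma good_cons_min (a : nat) w : uniq (a :: w) -> {in w, forall x, a <= x} ->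
  good w -> good (a :: w).
Proof.
move=> uaw mina gw; apply: good_cons => // q r s /mem_subseq sw.
have /mina: q \in w by apply: sw; rewrite !inE eqxx.
have /mina: s \in w by apply: sw; rewrite !inE eqxx !orbT.
rewrite /bad4; lia.
Qed.

(** In each pattern the third letter exceeds the first. *)
Lemma good_cons_max (a : nat) w : uniq (a :: w) -> {in w, forall x, x <= a} ->
  good w -> good (a :: w).
Proof.
move=> uaw maxa gw; apply: good_cons => // q r s /mem_subseq sw.
have /maxa: r \in w by apply: sw; rewrite !inE eqxx !orbT.
rewrite /bad4; lia.
Qed.

(** In each pattern the third letter exceeds the last. *)
Lemma good_rcons_max (a : nat) w : uniq (rcons w a) -> {in w, forall x, x <= a} ->
  good w -> good (rcons w a).
Proof.
move=> ua maxa gw; have := ua; rewrite rcons_uniq => /andP[_ uw].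
apply/goodP=> // p q r s.
rewrite -[[:: p; q; r; s]]/(rcons [:: p; q; r] s) => sw.
have rw : r \in rcons w a.
  by apply: (mem_subseq sw); rewrite !inE eqxx !orbT.
case: (eqVneq s a) => [->|nsa].
  have : r <= a by move: rw; rewrite mem_rcons inE => /predU1P[->|/maxa].
  rewrite /bad4; lia.
move/(goodP uw): gw; apply.
move: sw; rewrite -[rcons [:: p; q; r] s]/([:: p; q; r; s]).
(* The last bit of the mask tells whether the final [a] is used; if it were, [s] would be [a]. *)
move=> /subseqP[m szm E]; apply/subseqP; move: szm E; rewrite size_rcons.
case: (lastP m) => // m' b; rewrite size_rcons => -[szm].
rewrite -!cats1 mask_cat //=; case: b; last by rewrite cats0; exists m'.
rewrite cats1 -[[:: p; q; r; s]]/(rcons [:: p; q; r] s) => /rcons_inj[_ sa].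
by rewrite sa eqxx in nsa.
Qed.

(** An occurrence using both [a] and [b] has [b] as second letter, but in each pattern the third
    letter exceeds the second. *)
Lemma good_insert_max (a b : nat) w : uniq [:: a, b & w] ->
  {in a :: w, forall x, x <= b} -> good (a :: w) -> good [:: a, b & w].
Proof.
move=> u maxb gaw.
have uaw : uniq (a :: w).
  by apply: subseq_uniq u; rewrite /= eqxx; apply: subseq_cons.
have gw : good w by apply: good_subseq gaw => //; apply: subseq_cons.
have ubw : uniq (b :: w) by have /andP[] := u.
have maxw : {in w, forall x, x <= b} by move=> x xw; apply: maxb; rewrite inE xw orbT.
have leab : a <= b by apply: maxb; rewrite mem_head.
apply: good_cons => // [|q r s]; first exact: good_cons_max.
rewrite [subseq _ _]/=; case: eqP => [->|_] sw.
  have /maxw : r \in w by apply: (mem_subseq sw); rewrite mem_head.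
  rewrite /bad4; lia.
have /goodP/(_ gaw) := uaw; apply; by rewrite /= eqxx.
Qed.

(** * Words containing a run of least letters *)

Lemma good_iota_cat a j w : uniq w -> {in w, forall x, a + j <= x} ->
  good w -> good (iota a j ++ w).
Proof.
elim: j a => //= j IHj a uw gew gw.
have gew' : {in w, forall x, a.+1 + j <= x} by move=> x /gew; lia.
(* Each letter of the run is the minimum of the word that it starts. *)
apply: good_cons_min; last exact: IHj.
  rewrite /= mem_cat mem_iota cat_uniq iota_uniq uw andbT /=; apply/andP; split.
    by apply/norP; split; [lia|apply/negP=> /gew; lia].
  by apply/hasPn=> x /gew' /=; rewrite mem_iota; lia.
by move=> x; rewrite mem_cat mem_iota => /orP[|/gew']; lia.
Qed.

(** Serves to locate the second and fourth letters of an occurrence whose third letter is the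
    maximum. *)
Lemma subseq2_cat_cons (T : eqType) (x y : T) X Y : uniq (X ++ x :: Y) ->
  (subseq [:: x; y] (X ++ x :: Y) -> y \in Y) /\
  (subseq [:: y; x] (X ++ x :: Y) -> y \in X).
Proof.
elim: X => [|z X IHX] /=; first by
  rewrite eqxx sub1seq => /andP[/negPf xY _]; split=> //; case: eqP => [->|_];
  rewrite ?sub1seq ?xY // => /mem_subseq/(_ x); rewrite !inE eqxx orbT xY => /(_ isT).
rewrite mem_cat inE !negb_or => /andP[/and3P[zX /negPf zx zY] /IHX[IH1 IH2]].
split; first by rewrite eq_sym zx.
case: eqP => [->|_]; rewrite inE ?eqxx // => /IH2->; exact: orbT.
Qed.

(** An occurrence must start with [n], hence have [n.+1] third, its second letter in the run and its
    last in [R]. Then [q <= j < s < n], which fits no pattern. *)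
Lemma good_block n j R : uniq (n :: iota 1 j ++ n.+1 :: R) ->
  {in R, forall x, j < x < n} -> j < n -> good R ->
  good (n :: iota 1 j ++ n.+1 :: R).
Proof.
move=> u boundR ltjn gR.
have uR : uniq (n.+1 :: R).
  by move: u => /= /andP[_]; rewrite cat_uniq => /and3P[].
apply: good_cons => // [|q r s sw].
  apply: good_iota_cat => // [x|].
    by rewrite inE => /predU1P[->|/boundR]; lia.
  by apply: good_cons_max => // x /boundR; lia.
have le_w : {in iota 1 j ++ n.+1 :: R, forall x, x <= n.+1}.
  by move=> x; rewrite mem_cat inE mem_iota => /or3P[|/eqP->|/boundR]; lia.
have /le_w ler : r \in iota 1 j ++ n.+1 :: R.
  by apply: (mem_subseq sw); rewrite !inE eqxx !orbT.
apply/negP => bad; have Er : r = n.+1 by move: bad; rewrite /bad4; lia.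
have := u; rewrite Er in sw => /= /andP[_ u'].
have [sR qI] := subseq2_cat_cons s u'.
have {}sR : s \in R.
  by apply: sR; apply: subseq_trans sw; exact: subseq_cons.
have {qI} [_ qI] := subseq2_cat_cons q u'.
have : q \in iota 1 j.
  by apply: qI; apply: subseq_trans sw; rewrite /= !eqxx.
move/boundR: sR; rewrite mem_iota; move: bad; rewrite /bad4; lia.
Qed.

Lemma perm_iota_cat a L R k : perm_eq (L ++ R) (iota a k) -> sorted ltn L ->
  {in L & R, forall x y, x < y} ->
  L = iota a (size L) /\ perm_eq R (iota (a + size L) (k - size L)).
Proof.
move=> pLR sL ltLR; have szk : size L + size R = k.
  by rewrite -size_cat (perm_size pLR) size_iota.
(* Sorting [R] sorts the whole word, because [L] is sorted and lies below [R]. *)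
have E : L ++ sort leq R = iota a k.
  apply: (sorted_eq leq_trans anti_leq); last 1 first.
  - by apply: perm_trans pLR; rewrite perm_cat2l perm_sort.
  - rewrite (sorted_pairwise leq_trans) pairwise_cat -!(sorted_pairwise leq_trans).
    rewrite sort_sorted ?andbT; last exact: leq_total.
    apply/andP; split; last by apply: sub_sorted sL => x y; exact: ltnW.
    by apply/allrelP => x y xL; rewrite mem_sort => yR; apply/ltnW/ltLR.
  - exact: iota_sorted.
move: E; rewrite -[k in iota a k](subnKC (_ : size L <= k)); last by lia.
rewrite iotaD => /eqP; rewrite eqseq_cat ?size_iota // => /andP[/eqP EL /eqP ER].
by split=> //; rewrite -ER perm_sym perm_sort.
Qed.

(** * Lists of avoiders and removal of a leading 1 *)

Definition good_perms n := [seq w <- permutations (iota 1 n) | good w].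

(** Its size is the [b_n] of the overview; by the default of [head], the empty word belongs to it
    when [n = 0]. *)
Definition good_perms_n1 n := [seq w <- good_perms n | head 0 w != 1].

Lemma mem_good_perms n w : (w \in good_perms n) = good w && perm_eq w (iota 1 n).
Proof. by rewrite mem_filter mem_permutations. Qed.

Lemma uniq_good_perms n : uniq (good_perms n).
Proof. by rewrite filter_uniq // permutations_uniq. Qed.

Lemma perm_iota_uniq a k w : perm_eq w (iota a k) -> uniq w.
Proof. by move/perm_uniq->; apply: iota_uniq. Qed.

Lemma perm_iota_mem a k w : perm_eq w (iota a k) -> forall x, (x \in w) = (a <= x < a + k).
Proof. by move/perm_mem=> pw x; rewrite pw mem_iota. Qed.

Lemma good_map_addn j w : uniq w -> good (map (addn j) w) = good w.
Proof.
move=> uw; apply/idP/idP => [|gw]; first by apply: good_map => // x y _ _; lia.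
(* Subtracting [j] is strictly monotone on the shifted letters, all at least [j]. *)
apply: (@good_map (subn^~ j)).
- by rewrite map_inj_uniq // => x y /addnI.
- by move=> x y /mapP[x' _ ->] /mapP[y' _ ->]; lia.
by rewrite -map_comp (eq_map (_ : _ =1 id)) ?map_id // => x /=; lia.
Qed.

Lemma good_perms_shift a k R : perm_eq R (iota (a + 1) k) -> good R ->
  exists2 R', R' \in good_perms k & R = map (addn a) R'.
Proof.
move=> pR gR; exists (map (subn^~ a) R); last first.
  rewrite -map_comp -[LHS]map_id; apply/eq_in_map => x.
  by rewrite (perm_iota_mem pR) /=; lia.
have pR' : perm_eq (map (subn^~ a) R) (iota 1 k).
  have := perm_map (subn^~ a) pR; rewrite iotaDl -map_comp.
  have E : subn^~ a \o addn a =1 id by move=> x /=; lia.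
  by rewrite (eq_map E) map_id.
rewrite mem_good_perms pR' andbT -(good_map_addn a); last exact: perm_iota_uniq pR'.
rewrite -map_comp (_ : map _ R = R) //; rewrite -[RHS]map_id.
by apply/eq_in_map => x; rewrite (perm_iota_mem pR) /=; lia.
Qed.

(** A leading 1 is a minimum, so removing it and lowering the rest is a bijection onto shorter
    avoiders. *)
Lemma perm_good_perms n :
  perm_eq (good_perms n.+1)
    ([seq 1 :: map (addn 1) w | w <- good_perms n] ++ good_perms_n1 n.+1).
Proof.
have := permEl (perm_filterC (fun w => head 0 w == 1) (good_perms n.+1)).
rewrite perm_sym => /perm_trans; apply; rewrite perm_cat2r.
apply: uniq_perm => [||w]; first by rewrite filter_uniq // uniq_good_perms.
  rewrite map_inj_uniq ?uniq_good_perms // => u v [].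
  by apply: inj_map; exact: addnI.
rewrite mem_filter mem_good_perms; apply/andP/mapP => [[]|[v]].
  case: w => //= x w /eqP-> /andP[gw].
  rewrite perm_cons => pw; have uw := perm_iota_uniq pw.
  have gw' : good w.
    apply: good_subseq gw; last exact: subseq_cons.
    by rewrite /= uw (perm_iota_mem pw).
  by have [v vA ->] := good_perms_shift (a:=1) pw gw'; exists v.
rewrite mem_good_perms => /andP[gv pv] -> /=; split=> //.
have pv' : perm_eq (map (addn 1) v) (iota 2 n).
  by rewrite (perm_trans (perm_map _ pv)) // -iotaDl.
rewrite perm_cons pv' andbT; apply: good_cons_min.
- by rewrite /= (perm_iota_mem pv') (perm_iota_uniq pv').
- by move=> x; rewrite (perm_iota_mem pv'); lia.
by rewrite good_map_addn //; apply: perm_iota_uniq pv.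
Qed.

(** * Decomposition around the maximum *)

Lemma perm_insert_max n L R :
  perm_eq (L ++ n.+1 :: R) (iota 1 n.+1) = perm_eq (L ++ R) (iota 1 n).
Proof.
have -> : iota 1 n.+1 = rcons (iota 1 n) n.+1.
  by rewrite -[X in iota 1 X]addn1 iotaD cats1 add1n.
rewrite (permPl (permEl (perm_catCA L [:: n.+1] R))).
by rewrite perm_sym perm_rcons perm_cons perm_sym.
Qed.

(** The predicate separates [X] from [Y]; this keeps the families of the decomposition disjoint. *)
Lemma uniq_cat_pred (T : eqType) (p : pred T) X Y :
  uniq X -> uniq Y -> all p X -> all (predC p) Y -> uniq (X ++ Y).
Proof.
move=> uX uY /allP pX /allP pY; rewrite cat_uniq uX uY andbT /=.
by apply/hasPn => y Yy; apply: contra (pY y Yy) => /pX.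
Qed.

Lemma last_neq (T : eqType) (x : T) s : uniq (x :: s) -> s != [::] -> last x s != x.
Proof.
case: s => //= y s /andP[xys _] _; apply: contraNneq xys => <-; exact: mem_last.
Qed.

Definition insert_second (a : nat) w := head 0 w :: a :: behead w.

(** The fourth family, with maximum [n.+1]; [R] is kept in standard form and raised by [j]. *)
Definition block n j R := n :: iota 1 j ++ n.+1 :: map (addn j) R.

Lemma mem_good_perms_n1 n w :
  (w \in good_perms_n1 n) = [&& head 0 w != 1, good w & perm_eq w (iota 1 n)].
Proof. by rewrite mem_filter mem_good_perms. Qed.

Lemma good_perms_n1_cons n w : w \in good_perms_n1 n.+1 ->
  exists m R, [/\ w = m :: R, m != 1, 1 <= m <= n.+1 & 1 \in R].
Proof.
rewrite mem_good_perms_n1 => /and3P[w1 _ pw].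
have memw := perm_iota_mem pw; case: w w1 pw memw => [|m R] /= m1 pw memw.
  by have := perm_size pw.
exists m, R; split=> //; first by have := memw m; rewrite mem_head; lia.
by have := memw 1; rewrite inE eq_sym (negPf m1).
Qed.

Lemma block_mem n j R : 0 < j < n -> R \in good_perms (n - j) ->
  block n.+1 j R \in good_perms_n1 n.+2.
Proof.
move=> /andP[j0 ltjn]; rewrite mem_good_perms => /andP[gR pR].
have pR' : perm_eq (map (addn j) R) (iota (1 + j) (n - j)).
  by rewrite (perm_trans (perm_map _ pR)) // -iotaDl addnC.
have pb : perm_eq (block n.+1 j R) (iota 1 n.+2).
  (* Deleting [n.+2] and then [n.+1] leaves the run followed by the raised [R]. *)
  rewrite /block -cat_cons perm_insert_max (perm_insert_max n [::]) /=.
  by rewrite -[in iota 1 n](subnKC (ltnW ltjn)) iotaD perm_cat2l.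
rewrite mem_good_perms_n1 pb andbT; apply/andP; split; first by rewrite /=; lia.
apply: good_block; first exact: perm_iota_uniq pb.
- by move=> x; rewrite (perm_iota_mem pR'); lia.
- exact: ltnW.
by rewrite good_map_addn //; apply: perm_iota_uniq pR.
Qed.

(* R nonempty makes 1 an entry of L, so that m is an inversion top of m :: L. *)
Lemma block_split n m L R : uniq (m :: L ++ n.+2 :: R) -> m != 1 ->
  L != [::] -> R != [::] -> good (m :: L ++ n.+2 :: R) ->
  perm_eq (m :: L ++ R) (iota 1 n.+1) ->
  exists j R', [/\ 0 < j < n, R' \in good_perms (n - j) &
    m :: L ++ n.+2 :: R = block n.+1 j R'].
Proof.
move=> u m1 L0 R0 gw p.
have gP := elimT (goodP u) gw.
have u' := perm_iota_uniq p; have memp := perm_iota_mem p.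
have memL x : x \in L -> 1 <= x < n.+2.
  by move=> xL; rewrite -[n.+2]add1n -memp inE mem_cat xL orbT.
have memR x : x \in R -> 1 <= x < n.+2.
  by move=> xL; rewrite -[n.+2]add1n -memp inE mem_cat xL !orbT.
have memm : 1 <= m < n.+2 by rewrite -[n.+2]add1n -memp mem_head.
have sub1LR x d : x \in L -> d \in R ->
    subseq [:: m; x; n.+2; d] (m :: L ++ n.+2 :: R).
  move=> xL dR; rewrite /= eqxx; rewrite -[[:: x; _; _]]cat1s.
  by apply: cat_subseq; rewrite ?sub1seq //= eqxx sub1seq.
have /= [l lL] : exists l, l \in L by case: (L) L0 => // x ? _; exists x; exact: mem_head.
have /= [r rR] : exists r, r \in R by case: (R) R0 => // x ? _; exists x; exact: mem_head.
(* If 1 were in [R], then [m], [l], the maximum and 1 would form 2341 or 3241. *)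
have L1 : 1 \in L.
  have : 1 \in m :: L ++ R by rewrite memp; lia.
  rewrite inE eq_sym (negPf m1) mem_cat /= => /orP[//|oneR].
  have := gP _ _ _ _ (sub1LR l 1 lL oneR); have := memL l lL.
  have : l != 1.
    apply: contraTneq lL => ->; move: u' => /= /andP[_]; rewrite cat_uniq.
    by case/and3P=> _ /hasPn/(_ _ oneR).
  by rewrite /bad4; move: m1 memm; clear; lia.
(* Otherwise [m], 1, the maximum and [d] form 2143. *)
have ltRm d : d \in R -> d < m.
  move=> dR; have := gP _ _ _ _ (sub1LR 1 d L1 dR); have := memR d dR.
  have : d != m by apply: contraTneq dR => ->; move: u' => /= /andP[]; rewrite mem_cat negb_or => /andP[].
  by rewrite /bad4; move: m1 memm; clear; lia.
(* Otherwise [m] and [x] both exceed [d], giving 2341 or 3241. *)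
have ltLR : {in L & R, forall x d, x < d}.
  move=> x d xL dR; have := gP _ _ _ _ (sub1LR x d xL dR).
  have := ltRm d dR; have := memL x xL.
  have : x != d.
    apply: contraTneq xL => ->; move: u' => /= /andP[_]; rewrite cat_uniq.
    by case/and3P=> _ /hasPn/(_ _ dR).
  by rewrite /bad4; move: m1 memm; clear; lia.
(* An inversion of [L], the maximum and [r] would form 2143. *)
have noinv a b : a \in L -> subseq [:: a; b] L -> b < a -> False.
  move=> aL abL ltba; have := ltLR a r aL rR; have := memR r rR.
  have : subseq ([:: a; b] ++ [:: n.+2; r]) (m :: L ++ n.+2 :: R).
    apply: subseq_trans (subseq_cons _ _); apply: cat_subseq => //.
    by rewrite /= eqxx sub1seq.
  by move/gP; rewrite /bad4; move: ltba; clear; lia.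
have sL : sorted ltn L.
  rewrite (sorted_pairwise ltn_trans); apply/(pairwiseP 0) => i j iL jL ltij.
  have neq : nth 0 L i != nth 0 L j.
    rewrite nth_uniq //; first by move: ltij; clear; lia.
    by move: u' => /= /andP[_]; rewrite cat_uniq => /and3P[].
  apply: contraT; rewrite ltnNge negbK leq_eqVlt eq_sym (negPf neq) /=.
  move=> /noinv H; exfalso; apply: H; first exact: mem_nth.
  rewrite -[X in subseq _ X](cat_take_drop j) -cat1s; apply: cat_subseq.
    rewrite sub1seq -(nth_take 0 ltij); apply: mem_nth.
    by rewrite size_take; case: ifP.
  by rewrite (drop_nth 0) // /= eqxx sub0seq.
(* The second largest letter is not in [L], which lies below [r], nor in [R], which lies below
   [m]. *)
have mE : m = n.+1.
  have : n.+1 \in m :: L ++ R by rewrite memp; clear; lia.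
  rewrite inE mem_cat => /or3P[/eqP->//|nL|/ltRm]; last by move: memm; clear; lia.
  by have := ltLR _ _ nL rR; have := memR _ rR; clear; lia.
move: p; rewrite mE (perm_insert_max n [::]) /= => p.
have [LE pR] := perm_iota_cat p sL ltLR.
have szL : 0 < size L by rewrite lt0n size_eq0.
have szR : 0 < size R by rewrite lt0n size_eq0.
have szn : size L + size R = n by rewrite -size_cat (perm_size p) size_iota.
have gR : good R.
  apply: good_subseq gw => //; rewrite -cat_rcons -cat_cons; exact: suffix_subseq.
rewrite addnC in pR.
have [R' R'A RE] := good_perms_shift pR gR.
exists (size L), R'; split=> //; first by move: szL szR szn; clear; lia.
by rewrite /block -LE -RE.
Qed.

(** The place of [n.+2] tells the families apart: first, last, second, or strictly between the
    second and the last. *)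
Lemma perm_good_perms_n1 n :
  perm_eq (good_perms_n1 n.+2)
    ([seq n.+2 :: w | w <- good_perms n.+1] ++
     [seq rcons w n.+2 | w <- good_perms_n1 n.+1] ++
     [seq insert_second n.+2 w | w <- good_perms_n1 n.+1] ++
     [seq block n.+1 j R | j <- iota 1 n.-1, R <- good_perms (n - j)]).
Proof.
have uB k : uniq (good_perms_n1 k) by rewrite filter_uniq // uniq_good_perms.
apply: uniq_perm => // [|w].
  apply: (uniq_cat_pred (p := fun w => head 0 w == n.+2)).
  - by rewrite map_inj_uniq ?uniq_good_perms // => x y [].
  - apply: (uniq_cat_pred (p := fun w => last 0 w == n.+2)).
    + by rewrite map_inj_uniq // => x y /rcons_inj[].
    + apply: (uniq_cat_pred (p := fun w => nth 0 w 1 == n.+2)).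
      * rewrite map_inj_in_uniq // => x y.
        by move=> /good_perms_n1_cons[? [? [-> _ _ _]]]
                  /good_perms_n1_cons[? [? [-> _ _ _]]] [-> ->].
      * apply: allpairs_uniq_dep => [|j _|]; first exact: iota_uniq.
          exact: uniq_good_perms.
        move=> _ _ /allpairsPdep[j [R [jn _ ->]]] /allpairsPdep[k [S [kn _ ->]]] /=.
        (* The length of the run is recovered as the position of [n.+2] after the first letter. *)
        move=> [E]; have Ejk : j = k.
          have := congr1 (index n.+2) E; rewrite !index_cat !mem_iota !size_iota /= eqxx.
          by move: jn kn; rewrite !mem_iota; do 2?case: ifP; lia.
        move: E; rewrite -Ejk => /eqP; rewrite eqseq_cat // eqxx eqseq_cons eqxx /=.
        by move=> /eqP/(inj_map (@addnI j))->.
      * by apply/allP => _ /mapP[w _ ->] /=.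
      apply/allP => _ /allpairsPdep[[|j] [R [jn _ ->]]] //=.
      by move: jn; rewrite mem_iota.
    + by apply/allP => _ /mapP[w _ ->] /=; rewrite last_rcons.
    rewrite all_cat; apply/andP; split; apply/allP => w /=.
      move=> /mapP[v /[dup] /good_perms_n1_cons[m [R [-> _ _ R1]]] vB ->] /=.
      move: vB; rewrite mem_good_perms_n1 => /and3P[_ _ pv].
      have := pv; rewrite -(perm_insert_max n.+1 [:: m]) => /perm_iota_uniq.
      (* [R] contains 1, so some letter follows the maximum. *)
      by move=> /= /andP[_ u]; apply: last_neq => //; case: (R) R1.
    move=> /allpairsPdep[j [R [jn RA ->]]] /=.
    have bB : block n.+1 j R \in good_perms_n1 n.+2.
      by apply: block_mem => //; move: jn; rewrite mem_iota; lia.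
    move: bB; rewrite mem_good_perms_n1 => /and3P[_ _ /perm_iota_uniq].
    rewrite /= cat_uniq last_cat => /andP[_ /and3P[_ _ u]].
    apply: last_neq => //; move: RA; rewrite mem_good_perms => /andP[_ /perm_size].
    by rewrite size_iota; move: jn; rewrite mem_iota; case: (R) => //=; lia.
  - by apply/allP => _ /mapP[w _ ->] /=.
  rewrite !all_cat; apply/and3P; split; apply/allP => w /=.
  + move=> /mapP[v /good_perms_n1_cons[m [R [-> _ lem _]]] ->] /=; lia.
  + move=> /mapP[v /good_perms_n1_cons[m [R [-> _ lem _]]] ->] /=; lia.
  by move=> /allpairsPdep[j [R [_ _ ->]]] /=; lia.
rewrite !mem_cat; apply/idP/idP => [wB|].
  have := wB; rewrite mem_good_perms_n1 => /and3P[w1 gw pw].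
  have uw := perm_iota_uniq pw.
  have : n.+2 \in w by rewrite (perm_iota_mem pw); lia.
  (* Cut at the maximum; the family depends on whether the left part is empty, the right part is
     empty, or the left part is a single letter. *)
  case/splitPr E : _ / => [L R]; rewrite {}E in w1 gw pw uw *.
  have pLR := pw; rewrite perm_insert_max in pLR.
  have gLR : good (L ++ R).
    by apply: good_subseq gw => //; apply: cat_subseq => //; exact: subseq_cons.
  case: L => [|m L] in w1 gw pw uw pLR gLR *.
    by apply/orP/or_introl/mapP; exists R; rewrite // mem_good_perms gLR.
  have mB : m :: L ++ R \in good_perms_n1 n.+1 by rewrite mem_good_perms_n1 w1 gLR.
  have [R0|R0] := eqVneq R [::].
    by rewrite R0 cats1 cats0 in mB *; rewrite (map_f (rcons^~ n.+2) mB) orbT.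
  have [L0|L0] := eqVneq L [::].
    by rewrite L0 in mB *; rewrite (map_f (insert_second n.+2) mB) !orbT.
  rewrite cat_cons; have [j [R' [jn R'A ->]]] := block_split uw w1 L0 R0 gw pLR.
  apply/or4P/Or44/allpairsPdep; exists j, R'; split=> //.
  by rewrite mem_iota; lia.
(* Conversely, every member of the four families is an avoider that does not begin with 1. *)
have max_in k v : perm_eq v (iota 1 k) -> {in v, forall x, x <= k.+1}.
  by move=> pv x; rewrite (perm_iota_mem pv); lia.
case/or4P=> [/mapP[v]|/mapP[v]|/mapP[v]|/allpairsPdep[j [R [jn RA ->]]]].
- rewrite mem_good_perms => /andP[gv pv] ->.
  have p : perm_eq (n.+2 :: v) (iota 1 n.+2) by rewrite (perm_insert_max _ [::]).
  rewrite mem_good_perms_n1 p andbT /=; apply: good_cons_max => //.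
    exact: perm_iota_uniq p.
  exact: max_in.
- move=> vB; have [m [R [vE _ _ _]]] := good_perms_n1_cons vB; move: vB.
  rewrite mem_good_perms_n1 => /and3P[v1 gv pv] ->.
  have p : perm_eq (rcons v n.+2) (iota 1 n.+2).
    by rewrite -cats1 perm_insert_max cats0.
  rewrite mem_good_perms_n1 p andbT; apply/andP; split; first by move: v1; rewrite vE.
  by apply: good_rcons_max => //; [exact: perm_iota_uniq p|exact: max_in].
- move=> vB; have [m [R [vE _ _ _]]] := good_perms_n1_cons vB; move: vB.
  rewrite mem_good_perms_n1 vE => /and3P[v1 gv pv] ->.
  have p : perm_eq (insert_second n.+2 (m :: R)) (iota 1 n.+2).
    by rewrite (perm_insert_max _ [:: m]).
  rewrite mem_good_perms_n1 p andbT; apply/andP; split=> //.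
  by apply: good_insert_max => //; [exact: perm_iota_uniq p|exact: max_in].
by apply: block_mem => //; move: jn; rewrite mem_iota; lia.
Qed.

(** * Recurrences for the numbers of avoiders *)

Lemma size_good_permsS n :
  size (good_perms n.+1) = size (good_perms n) + size (good_perms_n1 n.+1).
Proof. by rewrite (perm_size (perm_good_perms n)) size_cat size_map. Qed.

(** The sum of [a_r] over [0 < r < n], with [r = n - j]. *)
Definition size_blocks n :=
  sumn [seq size (good_perms (n - j)) | j <- iota 1 n.-1].

(** The relation starts at [n.+2]: the sums at 0 and 1 are both empty, while [a_0 = 1]. *)
Lemma size_blocksS n : size_blocks n.+2 = size (good_perms n.+1) + size_blocks n.+1.
Proof.
rewrite /size_blocks /= subn1 /= (iotaDl 1 1) -map_comp.
by congr (_ + sumn _); apply: eq_map => j /=; rewrite add1n subSS.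
Qed.

Lemma size_good_perms_n1S n :
  size (good_perms_n1 n.+2) =
    size (good_perms n.+1) + (size (good_perms_n1 n.+1)).*2 + size_blocks n.
Proof.
rewrite (perm_size (perm_good_perms_n1 n)) !size_cat !size_map size_allpairs_dep.
by rewrite -addnn !addnA.
Qed.

(** Only [a_0 = 1] and [b_1 = 0] are found directly; the recurrences give the rest. *)
Lemma size_good_perms_small :
  [/\ size (good_perms 0) = 1, size (good_perms 1) = 1,
      size (good_perms 2) = 2 & size (good_perms 3) = 6].
Proof.
have a0 : size (good_perms 0) = 1.
  have -> : good_perms 0 = [:: [::]] by rewrite /good_perms /= (introT (goodP _)).
  by [].
have b1 : size (good_perms_n1 1) = 0.
  case E : (good_perms_n1 1) => [|w s] //.
  have /good_perms_n1_cons[m [R [_ m1 lem _]]] : w \in good_perms_n1 1.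
    by rewrite E mem_head.
  by lia.
have := size_good_permsS 0; have := size_good_permsS 1.
have := size_good_permsS 2; have := size_good_perms_n1S 0.
have := size_good_perms_n1S 1.
have -> : size_blocks 0 = 0 by []. have -> : size_blocks 1 = 0 by [].
by rewrite a0 b1; split; lia.
Qed.

(** Differencing two instances of the recurrence for [b] leaves one term of the block sum;
    [b_k = a_k - a_(k-1)] eliminates [b]. Negative terms change sides to stay in [nat]. *)
Lemma size_good_perms_rec n :
  size (good_perms n.+4) + 6 * size (good_perms n.+2) =
    5 * size (good_perms n.+3) + 3 * size (good_perms n.+1).
Proof.
have := size_good_permsS n.+1; have := size_good_permsS n.+2.
have := size_good_permsS n.+3; have := size_good_perms_n1S n.+1.
have := size_good_perms_n1S n.+2; have := size_blocksS n; lia.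
Qed.

(** * From words back to permutations *)

Lemma oneline_inj n : injective (@oneline n).
Proof.
move=> p q /eq_in_map pq; apply/permP => i; apply/val_inj.
by have [] := pq i (mem_enum _ i).
Qed.

Lemma perm_oneline n :
  perm_eq [seq oneline p | p <- enum 'S_n] (permutations (iota 1 n)).
Proof.
have u : uniq [seq oneline p | p <- enum 'S_n].
  by rewrite map_inj_uniq ?enum_uniq //; apply: oneline_inj.
have sub : {subset [seq oneline p | p <- enum 'S_n] <= permutations (iota 1 n)}.
  move=> _ /mapP[p _ ->]; rewrite mem_permutations uniq_perm ?iota_uniq //.
    rewrite map_inj_uniq ?enum_uniq // => i j [] /val_inj; exact: perm_inj.
  move=> x; rewrite mem_iota add1n ltnS; apply/mapP/idP => [[i _ ->]|]; first exact: (ltn_ord (p i)).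
  case: x => // x ltxn; exists ((p^-1)%g (Ordinal ltxn)); first by rewrite mem_enum.
  by rewrite permKV.
apply: uniq_perm; rewrite ?permutations_uniq //.
(* Inclusion suffices, since both lists have [n!] distinct elements. *)
apply: (uniq_min_size u sub _).2.
by rewrite size_permutations ?iota_uniq // size_iota size_map -cardE card_Sn.
Qed.

Lemma card_avoiders n : #|avoiders T23 n| = size (good_perms n).
Proof.
have := perm_size (perm_filter good (perm_oneline n)).
rewrite filter_map size_map => <-; rewrite cardE enumT /enum_mem; congr size.
by apply: eq_filter => p /=; rewrite inE.
Qed.

(** * Coefficients of the rational series *)

Local Open Scope ring_scope.

(** Only the last four terms of the convolution meet a coefficient of [p] of degree at most 3. *)
Lemma fps_mul_poly4 (R : comUnitRingType) (p : {poly R}) (g : fps R) n :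
  (size p <= 4)%N ->
  fps_mul (fps_poly p) g n.+3 =
    p`_0 * g n.+3 + p`_1 * g n.+2 + p`_2 * g n.+1 + p`_3 * g n.
Proof.
move=> szp; rewrite /fps_mul /fps_poly !big_ord_recr /= big1 => [|i _]; last first.
  by rewrite nth_default ?mul0r //; apply: leq_trans szp _; have := ltn_ord i; lia.
have [-> -> -> ->] : [/\ n.+3 - n = 3, n.+3 - n.+1 = 2, n.+3 - n.+2 = 1 &
    n.+3 - n.+3 = 0]%N by split; lia.
by ring.
Qed.

Lemma fps_inv_rec (R : comUnitRingType) (p : {poly R}) n :
  p`_0 = 1 -> (size p <= 4)%N ->
  [/\ fps_inv (fps_poly p) 0%N = 1,
      fps_inv (fps_poly p) 1%N = - p`_1,
      fps_inv (fps_poly p) 2%N = p`_1 ^+ 2 - p`_2 &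
      fps_inv (fps_poly p) n.+3 =
        - (p`_1 * fps_inv (fps_poly p) n.+2 + p`_2 * fps_inv (fps_poly p) n.+1
           + p`_3 * fps_inv (fps_poly p) n)].
Proof.
move=> p0 szp; set g := fps_inv _.
have U : fps_poly p 0 \is a GRing.unit by rewrite /fps_poly p0 unitr1.
have E := fps_mulV U; rewrite -/g in E.
have := E 0%N; have := E 1%N; have := E 2%N; have := E n.+3.
rewrite fps_mul_poly4 // /fps_mul !big_ord_recr !big_ord0 /= /fps_poly !coef1 /=.
rewrite !subnn p0 !mul1r !add0r => E3 E2 E1 g0.
have {}E1 : g 1%N = - p`_1.
  by move/eqP: E1; rewrite g0 mulr1 addrC addr_eq0 => /eqP.
split=> //.
  move/eqP: E2; rewrite addrC addr_eq0 g0 E1 => /eqP->.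
  by rewrite !subSS !subn0; ring.
by move/eqP: E3; rewrite -!addrA addr_eq0 => /eqP->; rewrite !addrA.
Qed.

Theorem theorem23 :
  avoid_gf [:: [:: 2; 1; 4; 3]; [:: 2; 3; 4; 1]; [:: 3; 2; 4; 1]]%N
  =1 fps_div (fps_poly (1 - 4 *: 'X + 3 *: 'X^2 - 'X^3 : {poly rat}))
             (fps_poly (1 - 5 *: 'X + 6 *: 'X^2 - 3 *: 'X^3 : {poly rat})).
Proof.
set P := (1 - 4 *: 'X + _ - _); set Q := (1 - 5 *: 'X + _ - _).
have polyE (a b c d : rat) : a%:P + b *: 'X + c *: 'X^2 + d *: 'X^3 = Poly [:: a; b; c; d].
  apply/polyP => i; rewrite coef_Poly !coefD coefC !coefZ coefX !coefXn.
  by case: i => [|[|[|[|i]]]] /=; rewrite ?nth_nil; ring.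
have EP : P = Poly [:: 1; -4; 3; -1].
  by rewrite -polyE !scaleNr scale1r.
have EQ : Q = Poly [:: 1; -5; 6; -3].
  by rewrite -polyE !scaleNr.
have szP : (size P <= 4)%N by rewrite EP; apply: size_Poly.
have szQ : (size Q <= 4)%N by rewrite EQ; apply: size_Poly.
have Q0 : Q`_0 = 1 by rewrite EQ coef_Poly.
(* An opaque name for [1/Q], known through its first values and its recurrence. *)
have [g gE] : exists g : nat -> rat, g = fps_inv (fps_poly Q) by eexists.
have [g0 g1 g2 _] := fps_inv_rec 0 Q0 szQ; rewrite -gE in g0 g1 g2.
have g_rec n : g n.+3 = 5 * g n.+2 - 6 * g n.+1 + 3 * g n.
  by have [_ _ _] := fps_inv_rec n Q0 szQ; rewrite -gE EQ !coef_Poly /= => ->; ring.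
rewrite EQ !coef_Poly /= in g1 g2.
have [f fE] : exists f : nat -> rat, f = fps_div (fps_poly P) (fps_poly Q) by eexists.
have f0 : f 0%N = 1.
  by rewrite fE /fps_div -gE /fps_mul big_ord1 g0 mulr1 /fps_poly EP coef_Poly.
have f1 : f 1%N = 1.
  rewrite fE /fps_div -gE /fps_mul !big_ord_recr big_ord0 /= g0 g1 /fps_poly EP.
  by rewrite !coef_Poly /=; ring.
have f2 : f 2%N = 2.
  rewrite fE /fps_div -gE /fps_mul !big_ord_recr big_ord0 /= g0 g1 g2 /fps_poly EP.
  by rewrite !coef_Poly /=; ring.
have fS n : f n.+3 = g n.+3 - 4 * g n.+2 + 3 * g n.+1 - g n.
  by rewrite fE /fps_div (fps_mul_poly4 _ _ szP) -gE EP !coef_Poly /=; ring.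
(* [P] has degree 3, so from degree 4 on the quotient obeys the recurrence of [Q]. The cases 0 and 1
   are apart because [fS] does not reach [f 1] and [f 2]. *)
have f_rec n : f n.+4 = 5 * f n.+3 - 6 * f n.+2 + 3 * f n.+1.
  case: n => [|[|n]]; rewrite ?f1 ?f2 !fS !g_rec ?g0 ?g1 ?g2; ring.
rewrite -fE => n; rewrite /avoid_gf card_avoiders.
have [a0 a1 a2 a3] := size_good_perms_small.
have [a aE] : exists a : nat -> rat, a = fun k => (size (good_perms k))%:R.
  exact: ex_intro _ _ erefl.
have a_rec k : a k.+4 = 5 * a k.+3 - 6 * a k.+2 + 3 * a k.+1.
  have E : a k.+4 + 6 * a k.+2 = 5 * a k.+3 + 3 * a k.+1.
    by rewrite aE -!natrM -!natrD size_good_perms_rec.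
  by apply: (addIr (6 * a k.+2)); rewrite E; ring.
(* Induction on windows of four: the order is three, but the recurrence does not involve [a 0]. *)
suff /(_ n)[] : forall k, [/\ a k = f k, a k.+1 = f k.+1, a k.+2 = f k.+2 &
    a k.+3 = f k.+3] by rewrite aE.
elim=> [|k [_ E1 E2 E3]]; last first.
  by split; [exact: E1|exact: E2|exact: E3|rewrite a_rec f_rec E1 E2 E3].
by rewrite aE a0 a1 a2 a3 f0 f1 f2 fS g_rec g0 g1 g2; split=> //; ring.
Qed.
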